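(* Let $\mathcal{S}=\{s_1,\dots,s_n\}$ ($n>1$) be an ordered finite generating set of a group $G$ which defines a Dehornoy-like ordering $<_D$. Assume that $\mathcal{S}$ has Property $F$, let $\mathcal{A}=\{a_1,\dots,a_n\}$ be the twisted generating set of $\mathcal{S}$, and let $<_A$ be the isolated ordering defined by $\mathcal{A}$. If $a_na_{n-1}a_n\neq a_{n-1}$, then: (1) $<_D$ is not Conradian, and the $<_D$-Conradian soul is $G^{(n)}$, the infinite cyclic subgroup generated by $s_n$. (2) $<_A$ is not Conradian, and the $<_A$-Conradian soul is $G^{(n)}$, the infinite cyclic subgroup generated by $a_n$.
   Context: A left ordering of $G$ is a total order $<$ with $g<g' \Rightarrow hg<hg'$; its positive cone is $\{g\in G : 1<g\}$. A left ordering $<$ is Conradian if $fg^k>g$ for all $f,g>1$ and all $k\ge2$. A subgroup $H\le G$ is $<$-convex if $h<g<h'$ with $h,h'\in H$, $g\in G$ implies $g\in H$. The $<$-Conradian soul is the maximal (under inclusion) $<$-convex subgroup of $G$ on which the restriction of $<$ is Conradian. Let $\mathcal{S}=\{s_1,\dots,s_n\}$ be an ordered finite generating set of $G$. A word on $\mathcal{S}\cup\mathcal{S}^{-1}$ is $i$-positive if it contains at least one $s_i$ and contains none of $s_1^{\pm1},\dots,s_{i-1}^{\pm1},s_i^{-1}$. $\Sigma_{\mathcal{S}}$ is the set of elements represented by an $i$-positive word for some $1\le i\le n$. $\mathcal{S}$ defines a Dehornoy-like ordering $<_D$ if $\Sigma_{\mathcal{S}}$ is the positive cone of a left ordering $<_D$.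 The twisted generating set of $\mathcal{S}$ is $\mathcal{A}=\{a_1,\dots,a_n\}$ with $a_i=(s_is_{i+1}\cdots s_n)^{(-1)^{n-i+1}}$; in particular $a_n=s_n^{-1}$. Let $P_{\mathcal{A}}^{(i)}$ be the set of elements represented by nonempty words in $a_i,\dots,a_n$ (no inverses), and $P_{\mathcal{A}}=P_{\mathcal{A}}^{(1)}$. $\mathcal{S}$ has Property $F$ if for all $1\le i\le n-1$: $a_i\,(P_{\mathcal{A}}^{(i+1)})^{-1}a_i^{-1}\subset P_{\mathcal{A}}^{(i)}$ and $a_i^{-1}(P_{\mathcal{A}}^{(i+1)})^{-1}a_i\subset P_{\mathcal{A}}^{(i)}$. When $\mathcal{S}$ has Property $F$ and defines a Dehornoy-like ordering, $P_{\mathcal{A}}$ is the positive cone of a left ordering, isolated in the space of left orderings of $G$; this ordering is $<_A$. $G^{(n)}$ is the subgroup generated by $s_n$ (equivalently by $a_n$). *)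

(* Defs.v *)
From HB Require Import structures.
From mathcomp Require Import all_boot.
From mathcomp Require Import boolp classical_sets.

Set Implicit Arguments.
Unset Strict Implicit.
Unset Printing Implicit Defensive.

Local Open Scope group_scope.
Local Open Scope classical_set_scope.

Definition is_subgroup (G : groupType) (H : set G) : Prop :=
  [/\ H 1, forall x y, H x -> H y -> H (x * y) & forall x, H x -> H x^-1].

Definition generated (G : groupType) (X : set G) : set G :=
  [set g | forall H : set G, is_subgroup H -> X `<=` H -> H g].

Definition infinite_order (G : groupType) (x : G) : Prop :=
  forall k : nat, 0 < k -> x ^+ k <> 1.

Definition left_ordering (G : groupType) (lt : G -> G -> Prop) : Prop :=
  [/\ forall g, ~ lt g g,
      forall g h k, lt g h -> lt h k -> lt g k,
      forall g h, g <> h -> lt g h \/ lt h g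
    & forall h g g', lt g g' -> lt (h * g) (h * g')].

Definition positive_cone (G : groupType) (lt : G -> G -> Prop) : set G :=
  [set g | lt 1 g].

(* The only left-invariant relation that can have P as its positive cone; see
   [left_ordering_coneE]. *)
Definition order_of_cone (G : groupType) (P : set G) (g h : G) : Prop :=
  P (g^-1 * h).

Lemma left_ordering_coneE (G : groupType) (lt : G -> G -> Prop) :
  left_ordering lt -> order_of_cone (positive_cone lt) = lt.
Proof.
case=> _ _ _ ltM; apply/funext => g; apply/funext => h; apply/propext; split.
  by move=> /(ltM g); rewrite mulg1 mulVKg.
by move=> /(ltM g^-1); rewrite mulVg.
Qed.

(* [conradian_on lt H]: the restriction of lt to the subgroup H is Conradian. *)
Definition conradian_on (G : groupType) (lt : G -> G -> Prop) (H : set G) :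
    Prop :=
  forall f g (k : nat), H f -> H g -> lt 1 f -> lt 1 g -> 1 < k ->
    lt g (f * g ^+ k).

Definition conradian (G : groupType) (lt : G -> G -> Prop) : Prop :=
  conradian_on lt [set: G].

Definition convex_subgroup (G : groupType) (lt : G -> G -> Prop) (H : set G) :
    Prop :=
  is_subgroup H /\
  forall h g h', H h -> H h' -> lt h g -> lt g h' -> H g.

(* Convex subgroups form a chain under inclusion, so the maximal one of a given
   kind, when it exists, is the largest one. *)
Definition is_conradian_soul (G : groupType) (lt : G -> G -> Prop)
    (H : set G) : Prop :=
  [/\ convex_subgroup lt H, conradian_on lt H
    & forall K, convex_subgroup lt K -> conradian_on lt K -> K `<=` H].

(* The family s_1, ..., s_n is indexed from 0 by 'I_n: s_i is the value of s at
   the ordinal i - 1. *)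

Definition generates (G : groupType) (n : nat) (s : 'I_n -> G) : Prop :=
  generated (range s) = [set: G].

(* A letter (j, false) stands for s_j and (j, true) for its inverse. *)
Definition word (n : nat) : Type := seq ('I_n * bool).

Definition word_val (G : groupType) (n : nat) (s : 'I_n -> G) (w : word n) : G :=
  \prod_(x <- w) (if x.2 then (s x.1)^-1 else s x.1).

Definition i_positive (n : nat) (i : 'I_n) (w : word n) : bool :=
  ((i, false) \in w) && all (fun x : 'I_n * bool => (i <= x.1) && (x != (i, true))) w.

Definition Sigma (G : groupType) (n : nat) (s : 'I_n -> G) : set G :=
  [set g | exists i, exists2 w, i_positive i w & word_val s w = g].

Definition defines_dehornoy_like (G : groupType) (n : nat) (s : 'I_n -> G) :
    Prop :=
  exists2 lt, left_ordering lt & positive_cone lt = Sigma s.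

Definition dehornoy_lt (G : groupType) (n : nat) (s : 'I_n -> G) :
    G -> G -> Prop :=
  order_of_cone (Sigma s).

(* With i counted from 0, the exponent (-1)^(n-(i+1)+1) is (-1)^(n-i). *)
Definition twisted (G : groupType) (n : nat) (s : 'I_n -> G) (i : 'I_n) : G :=
  let p := \prod_(j < n | i <= j) s j in
  if odd (n - i) then p^-1 else p.

(* Values of the nonempty positive words in the a_j with j >= i. *)
Definition positive_words (G : groupType) (n : nat) (a : 'I_n -> G) (i : nat) :
    set G :=
  [set g | exists w : seq 'I_n,
    [/\ w <> [::], all (fun j : 'I_n => i <= j) w & \prod_(j <- w) a j = g]].

Definition property_F (G : groupType) (n : nat) (s : 'I_n -> G) : Prop :=
  let a := twisted s in
  let P := positive_words a in
  forall i : 'I_n, i.+1 < n ->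
    [set a i * p^-1 * (a i)^-1 | p in P i.+1] `<=` P i /\
    [set (a i)^-1 * p^-1 * a i | p in P i.+1] `<=` P i.

(* When s has Property F and defines a Dehornoy-like ordering, this is the
   isolated left ordering with positive cone P_A. *)
Definition twisted_lt (G : groupType) (n : nat) (s : 'I_n -> G) :
    G -> G -> Prop :=
  order_of_cone (positive_words (twisted s) 0).

Lemma last_subproof (n : nat) : 1 < n -> n.-1 < n.
Proof. by case: n. Qed.

Lemma penult_subproof (n : nat) : 1 < n -> n.-2 < n.
Proof. by case: n => [|[|n]] // _; rewrite /= ltnS leqnSn. Qed.

Definition last_idx (n : nat) (n_gt1 : 1 < n) : 'I_n :=
  Ordinal (last_subproof n_gt1).

Definition penult_idx (n : nat) (n_gt1 : 1 < n) : 'I_n :=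
  Ordinal (penult_subproof n_gt1).

(* Main.v *)
Require Import Defs.
From mathcomp Require Import all_boot.
From mathcomp Require Import boolp classical_sets.

(** Count indices from 1 here, and write G^(i) for the subgroup generated by
    s_i, ..., s_n ([tail]). Since Sigma is a positive cone, every nontrivial
    element or its inverse is i-positive for some i; and since no i-positive
    word is trivial, that i is unique: the i-positive elements and their
    inverses make up exactly G^(i) minus G^(i+1). Multiplying an i-positive
    element by elements of G^(i+1) keeps it i-positive, so in a product the
    factor of smallest index decides the sign. Consequently one may reverse
    the sign of each of these layers independently and still have a positive
    cone ([flipped]), for which every G^(i) is again convex.

    Both orderings of the theorem are of this kind. The Dehornoy-like one
    flips nothing. For the twisted one, the relation s_i = a_i^e (s_(i+1) ...
    s_n)^-1, with e = (-1)^(n-i+1), shows that a_i^e is i-positive, so P_A is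
    contained in the cone whose i-th layer has sign e. Property F gives the
    converse: it lets a_i move past G^(i+1) without ever creating an inverse
    letter, so that every i-positive element, raised to the power e, is a
    positive word in a_i, ..., a_n ([layer_positive_words], [twisted_coneE]).
    In both orderings the layer n-1 keeps its sign, so one argument handles
    them together.

    The subgroup G^(n) is cyclic, hence abelian, and an ordering restricted
    to an abelian subgroup is Conradian. Put u = s_(n-1) s_n s_(n-1)^-1.
    Property F and a_n a_(n-1) a_n <> a_(n-1) force u to be (n-1)-positive
    ([ipos_conj_last]): both conjugates b s_n b^-1 = u and b^-1 s_n b of s_n
    by b = a_(n-1) are positive words in a_(n-1), a_n; if u lay in G^(n), it
    would be a negative power of s_n, and the second conjugate would be a
    root of s_n^-1, which is possible only if b inverts s_n. Once u is
    (n-1)-positive, write u = h s_(n-1) z with h in G^(n); then f = h u and g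
    = u satisfy f g^2 < g, because (f g^2)^-1 g = s_(n-1) s_n^-3 z
    ([not_conradian_on_tail]). Geometrically, on the ordered set of left
    cosets of G^(n), u fixes p = s_(n-1) G^(n) and carries the coset G^(n),
    which is fixed by h, at least as far as h p: the actions of u and h
    cross.

    Finally, a convex subgroup not contained in G^(n) contains G^(n-1)
    ([soul_last]), hence f and g, and so is not Conradian. *)

Set Implicit Arguments.
Unset Strict Implicit.
Unset Printing Implicit Defensive.

Local Open Scope group_scope.
Local Open Scope classical_set_scope.

(** * Subgroups *)

Lemma generated_subgroup {G : groupType} (X : set G) :
  is_subgroup (generated X).
Proof.
split=> [H [] // | x y gx gy H sH XH | x gx H sH XH]; case: (sH) => H1 HM HV.
- by apply: HM; [apply: gx | apply: gy].
- by apply: HV; apply: gx.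
Qed.

Lemma sub_generated {G : groupType} (X : set G) : X `<=` generated X.
Proof. by move=> x Xx H _; apply. Qed.

Lemma generated_min {G : groupType} (X H : set G) :
  is_subgroup H -> X `<=` H -> generated X `<=` H.
Proof. by move=> sH XH x; apply. Qed.

Lemma generated1V {G : groupType} (x : G) :
  generated [set x] = generated [set x^-1].
Proof.
have sub (y : G) : generated [set y^-1] `<=` generated [set y].
  have sg := generated_subgroup [set y]; case: (sg) => _ _ V.
  apply: generated_min => // _ ->; apply: V.
  exact: sub_generated.
by apply/seteqP; split; [rewrite -{1}(invgK x)|]; apply: sub.
Qed.

Lemma centralizer_subgroup {G : groupType} (x : G) :
  is_subgroup [set y | commute x y].
Proof.
split=> [|y z xy xz|y xy]; [exact: commute1|exact: commuteM|exact: commuteV].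
Qed.

Lemma generated1_commute {G : groupType} (x y z : G) :
  generated [set x] y -> generated [set x] z -> commute y z.
Proof.
move=> gy; move: z; apply: generated_min; first exact: centralizer_subgroup.
move=> _ ->; apply: commute_sym; move: y gy.
by apply: generated_min; [exact: centralizer_subgroup | move=> _ ->].
Qed.

(** * Layers of a word filtration *)

Section Layers.
Variables (G : groupType) (n : nat) (s : 'I_n -> G).
Implicit Types (i j : 'I_n) (k : nat) (w : word n) (x y t : G).

Definition tail k : set G :=
  [set g | exists2 w : word n, all (fun c : 'I_n * bool => k <= c.1) w &
    word_val s w = g].

Definition ipos i : set G :=
  [set g | exists2 w, i_positive i w & word_val s w = g].

Lemma word_val_cat w1 w2 :
  word_val s (w1 ++ w2) = word_val s w1 * word_val s w2.
Proof. by rewrite /word_val big_cat. Qed.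

Lemma word_val_cons (x : 'I_n * bool) w :
  word_val s (x :: w) = (if x.2 then (s x.1)^-1 else s x.1) * word_val s w.
Proof. by rewrite /word_val big_cons. Qed.

Lemma word_val1 (x : 'I_n * bool) :
  word_val s [:: x] = if x.2 then (s x.1)^-1 else s x.1.
Proof. by rewrite /word_val big_seq1. Qed.

Lemma tail_letter k (x : 'I_n * bool) :
  k <= x.1 -> tail k (if x.2 then (s x.1)^-1 else s x.1).
Proof. by move=> kx; exists [:: x]; rewrite ?word_val1 //= kx. Qed.

Lemma tail_subgroup k : is_subgroup (tail k).
Proof.
have t1 : tail k 1 by exists [::]; rewrite // /word_val big_nil.
have tM x y : tail k x -> tail k y -> tail k (x * y).
  move=> [u ku <-] [v kv <-]; exists (u ++ v); last exact: word_val_cat.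
  by rewrite all_cat ku.
split=> // x [w + <-]; elim: w => [|c w IHw] /=.
  by rewrite /word_val big_nil invg1.
case/andP=> kc /IHw kw; rewrite word_val_cons invgM; apply: tM kw _.
have := @tail_letter k (c.1, ~~ c.2) kc.
by case: (c.2) => //=; rewrite invgK.
Qed.

Lemma tail_gen k i : k <= i -> tail k (s i).
Proof. exact: (@tail_letter k (i, false)). Qed.

Lemma tail_min k (H : set G) :
  is_subgroup H -> (forall i, k <= i -> H (s i)) -> tail k `<=` H.
Proof.
case=> H1 HM HV Hs x [w + <-]; elim: w => [|c w IHw] /=.
  by rewrite /word_val big_nil.
case/andP=> kc /IHw Hw; rewrite word_val_cons; apply: HM Hw.
by case: ifP => _; [apply: HV|]; apply: Hs.
Qed.

Lemma tail_leq k l : k <= l -> tail l `<=` tail k.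
Proof.
move=> kl; apply: tail_min; first exact: tail_subgroup.
by move=> i li; apply: tail_gen; apply: leq_trans li.
Qed.

Lemma tail_eq1 k x : n <= k -> tail k x -> x = 1.
Proof.
move=> nk; move: x; apply: tail_min => [|i]; last first.
  by move/(leq_trans nk); rewrite leqNgt ltn_ord.
by split=> [//|x y -> ->|x ->]; rewrite ?mulg1 ?invg1.
Qed.

Lemma ipos_tail i : ipos i `<=` tail i.
Proof.
move=> x [w /andP[_ /allP wi] <-]; exists w => //.
by apply/allP => c /wi /andP[].
Qed.

Lemma ipos_gen i : ipos i (s i).
Proof.
exists [:: (i, false)]; last by rewrite word_val1.
by rewrite /i_positive inE eqxx /= leqnn andbT xpair_eqE andbF.
Qed.

Lemma tail_letters i w : all (fun c : 'I_n * bool => i < c.1) w ->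
  all (fun c : 'I_n * bool => (i <= c.1) && (c != (i, true))) w.
Proof.
apply: sub_all => c ic; rewrite (ltnW ic) /=; apply: contraTneq ic => ->.
by rewrite ltnn.
Qed.

Lemma tail_ipos {i t x} : tail i.+1 t -> ipos i x -> ipos i (t * x).
Proof.
move=> [u ui <-] [w /andP[iw wi] <-]; exists (u ++ w); last exact: word_val_cat.
by rewrite /i_positive mem_cat iw orbT all_cat wi tail_letters.
Qed.

Lemma ipos_tailr {i t x} : tail i.+1 t -> ipos i x -> ipos i (x * t).
Proof.
move=> [u ui <-] [w /andP[iw wi] <-]; exists (w ++ u); last exact: word_val_cat.
by rewrite /i_positive mem_cat iw all_cat wi tail_letters.
Qed.

Lemma iposM {i x y} : ipos i x -> ipos i y -> ipos i (x * y).
Proof.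
move=> [u /andP[iu ui] <-] [w /andP[iw wi] <-]; exists (u ++ w).
  by rewrite /i_positive mem_cat iu all_cat ui wi.
exact: word_val_cat.
Qed.

(** An i-positive element is a product of elements of the (i+1)-st tail and of
    at least one s_i: this is the induction principle that lets the rest of the
    proof ignore words. *)
Lemma ipos_ind i (D : set G) :
    D (s i) ->
    (forall x y, D x -> D y -> D (x * y)) ->
    (forall t x, tail i.+1 t -> D x -> D (t * x)) ->
    (forall t x, tail i.+1 t -> D x -> D (x * t)) ->
  ipos i `<=` D.
Proof.
move=> Ds DM Dl Dr x [w /andP[iw wi] <-].
suff: if (i, false) \in w then D (word_val s w)
      else tail i.+1 (word_val s w) by rewrite iw.
elim: w wi {iw x} => [_|c w IHw /= /andP[/andP[ic ci] /IHw{IHw}]].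
  by rewrite /word_val big_nil; case: (tail_subgroup i.+1).
rewrite word_val_cons inE; have [<- /=|nci] := eqVneq (i, false) c.
  by case: ifP => _; [apply: DM | move=> /Dr; apply].
have {ic ci nci} ic : i < c.1.
  rewrite ltn_neqAle ic andbT; apply: contraNneq ci => /val_inj ec.
  by move: nci; rewrite ec; case: (c) => ? [] /=; rewrite eqxx.
have tc := tail_letter ic; case: ifP => _; first exact: Dl.
by case: (tail_subgroup i.+1) => _ tM _; apply: tM.
Qed.

(** Splitting at the first occurrence of s_i: when z is i-positive, h * s_i is a
    smaller positive element, which brings s_i into convex subgroups. *)
Lemma ipos_first i :
  ipos i `<=` [set x | exists h z,
    [/\ tail i.+1 h, tail i.+1 z \/ ipos i z & x = h * s i * z]].
Proof.
have [t1 tM _] := tail_subgroup i.+1.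
apply: ipos_ind => /=.
- by exists 1, 1; split; [|left|rewrite mul1g mulg1].
- move=> _ _ [h [z [hP zP ->]]] [h' [z' [hP' zP' ->]]].
  exists h, (z * (h' * s i * z')); split; [| right | rewrite !mulgA] => //.
  have p : ipos i (h' * s i * z').
    have q := tail_ipos hP' (ipos_gen i).
    by case: zP' => [/ipos_tailr|/(iposM q)]; [apply|].
  by case: zP => [/tail_ipos|/iposM]; apply.
- move=> t _ tP [h [z [hP zP ->]]]; exists (t * h), z.
  by split; rewrite ?mulgA //; apply: tM.
- move=> t _ tP [h [z [hP zP ->]]]; exists h, (z * t); split; rewrite ?mulgA //.
  by case: zP => zP; [left; apply: tM | right; apply: ipos_tailr].
Qed.

Lemma iposX {i x} k : 0 < k -> ipos i x -> ipos i (x ^+ k).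
Proof.
case: k => // k _ ix; elim: k => [|k IHk]; first by rewrite expg1.
by rewrite expgS; apply: iposM.
Qed.

End Layers.

(** * Sign-flipped orderings *)

Section Flipped.
Variables (G : groupType) (n : nat) (s : 'I_n -> G).
Hypothesis s_dehornoy : defines_dehornoy_like s.
Implicit Types (i j : 'I_n) (k : nat) (x y t : G).

Lemma ipos_neq1 i : ~ ipos s i 1.
Proof.
case: s_dehornoy => lt [irr _ _ _] cone [w iw w1]; apply: (irr 1).
by rewrite -[lt 1 1]/(positive_cone lt 1) cone; exists i, w.
Qed.

Lemma ipos_total x : x <> 1 -> exists i, ipos s i x \/ ipos s i x^-1.
Proof.
case: s_dehornoy => lt [_ _ tot ltM] cone /tot.
have posE y : lt 1 y -> exists i, ipos s i y.
  rewrite -[lt 1 y]/(positive_cone lt y) cone => -[i [w iw wy]].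
  by exists i, w.
case=> [/(ltM x^-1)|/posE[i ix]]; last by exists i; left.
by rewrite mulVg mulg1 => /posE[i ix]; exists i; right.
Qed.

Variable eps : 'I_n -> bool.

(** The positive elements of index i, for the ordering whose i-th layer has been
    reversed when [eps i] is false. *)
Definition layer i : set G := [set x | ipos s i (if eps i then x else x^-1)].

Definition flipped : set G := [set x | exists i, layer i x].

Lemma layer_tail i : layer i `<=` tail s i.
Proof.
rewrite /layer => x /=; case: (eps i) => /ipos_tail //.
by have [_ _ V] := tail_subgroup s i; move/V; rewrite invgK.
Qed.

Lemma tail_layer i t x : tail s i.+1 t -> layer i x -> layer i (t * x).
Proof.
have [_ _ V] := tail_subgroup s i.+1; rewrite /layer /=.
by case: (eps i) => tt; [apply: tail_ipos | rewrite invgM; apply/ipos_tailr/V].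
Qed.

Lemma layer_tailr i t x : tail s i.+1 t -> layer i x -> layer i (x * t).
Proof.
have [_ _ V] := tail_subgroup s i.+1; rewrite /layer /=.
by case: (eps i) => tt; [apply: ipos_tailr | rewrite invgM; apply/tail_ipos/V].
Qed.

Lemma layerM i x y : layer i x -> layer i y -> layer i (x * y).
Proof.
rewrite /layer /=; case: (eps i) => xP yP; first exact: iposM.
by rewrite invgM; apply: iposM.
Qed.

(** Otherwise x^-1 * x would be an i-positive or i-negative expression of 1. *)
Lemma layer_disjoint_tail i k x : i < k -> tail s k x -> ~ layer i x.
Proof.
move=> ik kx; have {kx} ix := tail_leq ik kx.
have [_ _ /(_ x ix) ix'] := tail_subgroup s i.+1.
move/(tail_layer ix'); rewrite mulVg /layer /= invg1 if_same.
exact: ipos_neq1.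
Qed.

(** The factor of larger index lies in the tail absorbed by the other one. *)
Lemma layerM_min i j x y : layer i x -> layer j y ->
  exists2 k : 'I_n, val k = minn i j & layer k (x * y).
Proof.
move=> ix jy; case: (ltngtP i j) => ij.
- by exists i => //; apply/layer_tailr/ix/(tail_leq ij)/layer_tail.
- by exists j => //; apply/tail_layer/jy/(tail_leq ij)/layer_tail.
- by exists i => //; apply: layerM ix _; rewrite (val_inj ij).
Qed.

Lemma flippedM x y : flipped x -> flipped y -> flipped (x * y).
Proof. by move=> [i ix] [j jy]; have [k _] := layerM_min ix jy; exists k. Qed.

Lemma flipped_neq1 : ~ flipped 1.
Proof.
by case=> i; rewrite /layer /= invg1 if_same; apply: ipos_neq1.
Qed.

Lemma flipped_total x : x <> 1 -> flipped x \/ flipped x^-1.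
Proof.
move/ipos_total=> [i ix]; suff: layer i x \/ layer i x^-1.
  by case=> h; [left|right]; exists i.
by rewrite /layer /= invgK; case: (eps i); case: ix; [left|right|right|left].
Qed.

(** If h < g < h' then h^-1 g and g^-1 h' are positive, with product in the
    subgroup; as nothing cancels in lower layers, both factors lie in it. *)
Lemma convex_tail k : convex_subgroup (order_of_cone flipped) (tail s k).
Proof.
have [_ M V] := tail_subgroup s k.
split=> [|h g h' hk hk' [i ix] [j jy]]; first exact: tail_subgroup.
have kg : tail s k (h^-1 * g * (g^-1 * h')) by rewrite mulgA mulgK; auto.
have [m mij ml] := layerM_min ix jy.
have km : k <= m by rewrite leqNgt; apply/negP => /layer_disjoint_tail/(_ kg).
rewrite -(mulVKg h g); apply: M => //; apply: tail_leq (layer_tail ix).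
by apply: leq_trans km _; rewrite mij geq_minl.
Qed.

(** The products of x in layer i by t in the next tail stay in layer i, so that
    x^-1 < t < x. *)
Lemma convex_absorbs_tail (K : set G) i x :
    convex_subgroup (order_of_cone flipped) K ->
  K x -> layer i x -> tail s i.+1 `<=` K.
Proof.
move=> [[_ _ KV] Kc] Kx ix t it; apply: Kc (KV _ Kx) (Kx) _ _.
  by exists i; rewrite invgK; apply: layer_tailr.
have [_ _ V] := tail_subgroup s i.+1.
by exists i; apply/tail_layer/ix/V.
Qed.

End Flipped.

(** * Positive words *)

Section PositiveWords.
Variables (G : groupType) (n : nat) (a : 'I_n -> G).

Lemma positive_words_gen k (j : 'I_n) : k <= j -> positive_words a k (a j).
Proof. by move=> kj; exists [:: j]; rewrite /= kj big_seq1. Qed.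

Lemma positive_words_leq k l : k <= l ->
  positive_words a l `<=` positive_words a k.
Proof.
move=> kl x [w [w0 lw <-]]; exists w; split=> //.
by apply: sub_all lw => j; apply: leq_trans.
Qed.

Lemma positive_wordsM k x y :
  positive_words a k x -> positive_words a k y -> positive_words a k (x * y).
Proof.
move=> [u [u0 ku <-]] [w [w0 kw <-]]; exists (u ++ w); split.
- by case: u u0 {ku}.
- by rewrite all_cat ku.
- by rewrite big_cat.
Qed.

Lemma positive_words_ind k (D : set G) :
    (forall j : 'I_n, k <= j -> D (a j)) ->
    (forall (j : 'I_n) x, k <= j -> D x -> D (a j * x)) ->
  positive_words a k `<=` D.
Proof.
move=> Da DM _ [w [w0 + <-]]; elim: w w0 => // j [|i w] IHw _ /andP[kj kw].
  by rewrite big_seq1; apply: Da.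
by rewrite big_cons; apply: DM => //; apply: IHw.
Qed.

End PositiveWords.

(** * The twisted cone *)

Section Twisted.
Variables (G : groupType) (n : nat) (s : 'I_n -> G).
Hypothesis s_dehornoy : defines_dehornoy_like s.
Hypothesis s_F : property_F s.
Implicit Types (i j : 'I_n) (k : nat) (x y t : G).

Let a := twisted s.
Let P := positive_words a.

Lemma suffix_prodS i :
  \prod_(j < n | i <= j) s j = s i * \prod_(j < n | i < j) s j.
Proof.
pose F k := odflt 1 (omap s (insub k)).
have FE k : \prod_(j < n | k <= j) s j = \prod_(k <= j < n) F j.
  by rewrite big_geq_mkord; apply: eq_bigr => j _; rewrite /F valK.
by rewrite !FE big_ltn // {1}/F valK.
Qed.

Lemma suffix_prod_tail k : tail s k (\prod_(j < n | k <= j) s j).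
Proof.
have [t1 tM _] := tail_subgroup s k.
by apply: big_ind => // j; apply: tail_gen.
Qed.

Definition twist_sign i : bool := ~~ odd (n - i).

(** s_i is the quotient of two consecutive suffix products, and a_i is such a
    suffix product up to sign. *)
Lemma twistedE i : exists2 t, tail s i.+1 t &
  s i = (if twist_sign i then a i else (a i)^-1) * t.
Proof.
have [_ _ tV] := tail_subgroup s i.+1.
exists (\prod_(j < n | i < j) s j)^-1; first exact/tV/suffix_prod_tail.
rewrite /twist_sign /a /twisted suffix_prodS.
by case: (odd _); rewrite /= ?invgK mulgK.
Qed.

Lemma twisted_layer i : layer s twist_sign i (a i).
Proof.
have [_ _ tV] := tail_subgroup s i.+1; have [t /tV it si] := twistedE i.
suff -> : layer s twist_sign i (a i) = ipos s i (s i * t^-1).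
  exact/ipos_tailr/ipos_gen.
by rewrite si mulgK.
Qed.

Lemma positive_words_tail k : P k `<=` tail s k.
Proof.
have [_ tM _] := tail_subgroup s k.
have tG j : k <= j -> tail s k (a j).
  by move=> kj; apply/(tail_leq kj)/layer_tail/twisted_layer.
by apply: positive_words_ind => // j x /tG; apply: tM.
Qed.

Lemma positive_words_flipped k : P k `<=` flipped s twist_sign.
Proof.
have aP j : flipped s twist_sign (a j) by exists j; apply: twisted_layer.
by apply: positive_words_ind => // j x _; apply: flippedM.
Qed.

Lemma property_F_conj i x : P i.+1 x ->
  P i (a i * x^-1 * (a i)^-1) /\ P i ((a i)^-1 * x^-1 * a i).
Proof.
move=> Px; have lt_i : i.+1 < n.
  case: Px => -[|j w] [] // _ /andP[ij _] _.
  exact: leq_ltn_trans ij (ltn_ord j).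
by have [F1 F2] := s_F lt_i; split; [apply: F1 | apply: F2]; exists x.
Qed.

(** The inductive step of [layer_positive_words]: a sign trichotomy on the
    tail of index i+1 is propagated to the layer i. *)
Section LayerStep.
Variable i : 'I_n.
Hypothesis tailE : forall t, tail s i.+1 t ->
  [\/ t = 1, P i.+1 t | P i.+1 t^-1].

(** Property F in the form a_i p^-1 = q a_i with q positive. *)
Lemma mul_twisted_tail t : tail s i.+1 t -> P i (a i * t).
Proof.
have Pa : P i (a i) by apply: positive_words_gen.
case/tailE=> [->|Pt|/property_F_conj[+ _]]; first by rewrite mulg1.
  by apply: positive_wordsM Pa _; apply: positive_words_leq Pt.
by rewrite invgK => /positive_wordsM/(_ Pa); rewrite mulgVK.
Qed.

(** The last a_i of a positive word absorbs every element of the tail on its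
    right, and a positive word with no a_i lies in the tail. *)
Lemma positive_words_absorb_tail x t :
  P i x -> tail s i.+1 t -> P i (x * t) \/ tail s i.+1 x.
Proof.
have [_ tM _] := tail_subgroup s i.+1; move=> + it; move: x.
have aP j : i <= j -> P i (a j * t) \/ tail s i.+1 (a j).
  rewrite leq_eqVlt => /predU1P[/val_inj <-|ij].
    by left; apply: mul_twisted_tail.
  by right; apply: positive_words_tail; apply: positive_words_gen.
pose D := [set x | P i (x * t) \/ tail s i.+1 x].
apply: (@positive_words_ind _ _ _ _ D) => //=.
move=> j x ij [Px|ix].
  by left; rewrite -mulgA; apply: positive_wordsM Px; apply: positive_words_gen.
move: ij; rewrite leq_eqVlt => /predU1P[/val_inj <-|ij].
  by left; rewrite -mulgA; apply: mul_twisted_tail; apply: tM.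
right; apply: tM ix; apply: positive_words_tail; exact: positive_words_gen.
Qed.

Lemma tail_twisted_tail t t' :
  tail s i.+1 t -> tail s i.+1 t' -> P i (t * a i * t').
Proof.
have [_ tM _] := tail_subgroup s i.+1.
move=> it it'; have Pat' := mul_twisted_tail it'; rewrite -mulgA.
case: (tailE it) => [->|Pt|Pt]; first by rewrite mul1g.
  by apply: positive_wordsM Pat'; apply: positive_words_leq Pt.
have [_] := property_F_conj Pt; rewrite invgK => Pw.
rewrite -(mulVKg (a i) (t * _)) !mulgA -(mulgA (a i)) -(mulgA (a i)).
have [Pwt'|iw] := positive_words_absorb_tail Pw it'; last first.
  by rewrite -mulgA; apply: mul_twisted_tail; apply: tM.
by rewrite -mulgA; apply: positive_wordsM Pwt'; apply: positive_words_gen.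
Qed.

Lemma layer_positive_words_step : layer s twist_sign i `<=` P i.
Proof.
have [t1 tM tV] := tail_subgroup s i.+1.
(* Multiplication by the tail can leave the positive words, so the induction on
   i-positive elements is run on the elements for which it never does. *)
pose E := [set x | forall t t',
  tail s i.+1 t -> tail s i.+1 t' -> P i (t * x * t')].
have EM x y : E x -> E y -> E (x * y).
  move=> Ex Ey t t' it it'; rewrite mulgA -(mulgA (t * x)).
  apply: positive_wordsM; first by rewrite -(mulg1 (t * x)); apply: Ex.
  by rewrite -(mul1g y); apply: Ey.
have El t x : tail s i.+1 t -> E x -> E (t * x).
  by move=> it Ex u u' iu iu'; rewrite (mulgA u); apply: Ex => //; apply: tM.
have Er t x : tail s i.+1 t -> E x -> E (x * t).
  move=> it Ex u u' iu iu'; rewrite (mulgA u) -(mulgA (u * x)).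
  by apply: Ex => //; apply: tM.
have Ea : E (a i) by move=> t t'; apply: tail_twisted_tail.
suff sub : ipos s i `<=` [set x | E (if twist_sign i then x else x^-1)].
  move=> x /sub; rewrite /=; case: (twist_sign i); rewrite ?invgK;
    by move=> /(_ 1 1 t1 t1); rewrite mulg1 mul1g.
have [t it si] := twistedE i.
apply: ipos_ind => [|x y|u x iu|u x iu] /=; rewrite ?si ?invgM;
  case: (twist_sign i); rewrite ?invgK; auto.
Qed.

End LayerStep.

(** Descending induction on i: once the deeper layers consist of positive words,
    every element of the tail of index i+1 is trivial, a positive word, or the
    inverse of one, as the inductive step requires. *)
Lemma layer_positive_words i : layer s twist_sign i `<=` P i.
Proof.
have [d] := ubnP (n - i); elim: d i => // d IHd i /ltnSE nid.
apply: layer_positive_words_step => t it.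
have layerP x j : tail s i.+1 x -> layer s twist_sign j x -> P i.+1 x.
  move=> ix jx; have ij : i < j.
    rewrite ltnNge; apply/negP => ji.
    exact: (@layer_disjoint_tail _ _ _ s_dehornoy _ j i.+1 x ji ix jx).
  apply: positive_words_leq (ij) _ _; apply: IHd jx.
  by apply: leq_trans nid; apply: ltn_sub2l.
have [_ _ tV] := tail_subgroup s i.+1.
have [->|/eqP t1] := eqVneq t 1; first exact: Or31.
have [] := flipped_total s_dehornoy twist_sign t1 => -[j] /layerP tP.
  by apply: Or32; apply: tP.
by apply: Or33; apply: tP; apply: tV.
Qed.

Lemma twisted_coneE : P 0 = flipped s twist_sign.
Proof.
apply/seteqP; split; first exact: positive_words_flipped.
by move=> x [i /layer_positive_words]; apply: positive_words_leq.
Qed.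

End Twisted.

(** * The Conradian soul *)

Section Soul.
Variables (G : groupType) (n : nat) (s : 'I_n -> G).
Hypothesis s_dehornoy : defines_dehornoy_like s.
Variable eps : 'I_n -> bool.
Let lt := order_of_cone (flipped s eps).

(** The failure of the Conradian inequality is explicit: if
    u = s_i t s_i^-1 = h s_i z, then u^-1 s_i = s_i t^-1, whence
    (h u * u^2)^-1 * u = u^-3 s_i z = s_i t^-3 z, which is i-positive. *)
Lemma not_conradian_on_tail (K : set G) (i : 'I_n) t :
    is_subgroup K -> tail s i `<=` K -> eps i -> tail s i.+1 t ->
    ipos s i (s i * t * (s i)^-1) ->
  ~ conradian_on lt K.
Proof.
move=> [_ KM _] iK ei it iu conK; set u := s i * t * (s i)^-1 in iu.
have [h [z [ih iz uE]]] := ipos_first iu.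
have ihu := tail_ipos ih iu.
have Q x : ipos s i x -> flipped s eps x by exists i; rewrite /layer /= ei.
have Ku : K u by apply/iK/ipos_tail.
have /conK/(_ Ku) : K (h * u) by apply/iK/ipos_tail.
rewrite /lt /order_of_cone !invg1 !mul1g => /(_ 2%N (Q _ ihu) (Q _ iu) isT).
set y := (_ * _) => Qy; apply: (flipped_neq1 s_dehornoy (eps := eps)).
rewrite -(mulgV y); apply: flippedM => //; apply: Q.
have -> : y^-1 = s i * (t^-1 * t^-1 * t^-1) * z.
  have hu : h^-1 * u = s i * z by rewrite uE -mulgA mulKg.
  have -> : y^-1 = u^-1 * u^-1 * u^-1 * (h^-1 * u) by rewrite /y expg2 !gnorm.
  by rewrite hu /u !gnorm.
have [_ tM tV] := tail_subgroup s i.+1.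
have it' := tV _ it; have it3 := tM _ _ (tM _ _ it' it') it'.
have ist := ipos_tailr it3 (ipos_gen s i).
by case: iz => iz; [apply: ipos_tailr | apply: iposM].
Qed.

Variables l i : 'I_n.
Hypotheses (il : l = i.+1 :> nat) (ln : n = l.+1).

Lemma tail_last : tail s l = generated [set s l].
Proof.
apply/seteqP; split.
  apply: tail_min => [|j lj]; first exact: generated_subgroup.
  have -> : j = l.
    by apply: val_inj; apply/eqP; rewrite eqn_leq lj -ltnS -ln ltn_ord.
  exact: sub_generated.
apply: generated_min; first exact: tail_subgroup.
by move=> _ ->; apply: tail_gen.
Qed.

Lemma conradian_on_last : conradian_on lt (generated [set s l]).
Proof.
move=> f g [|[|k]] // fl gl.
rewrite /lt /order_of_cone !invg1 !mul1g => fP gP _.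
have -> : g^-1 * (f * g ^+ k.+2) = f * g ^+ k.+1.
  by rewrite mulgA -(commuteV (generated1_commute fl gl)) -mulgA expgS mulKg.
apply: flippedM => //; elim: k => [|k IHk]; first by rewrite expg1.
by rewrite expgS; apply: flippedM.
Qed.

(** Let the convex subgroup K contain a positive element x outside the last
    tail; it has to be shown that K contains the tail of index i. The tail
    following the layer of x is absorbed by K, which settles the case of a
    layer of index less than i. If x lies in layer i, then x = h s_i z with h
    in K, and either z is in K or 1 < h s_i < x; in both cases s_i is in K. *)
Lemma soul_last :
    eps i -> ipos s i (s i * s l * (s i)^-1) ->
  ~ conradian lt /\ is_conradian_soul lt (generated [set s l]).
Proof.
move=> ei iu; have il' : tail s i.+1 (s l) by apply: tail_gen; rewrite il.
split.
  have sT : is_subgroup [set: G] by [].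
  by have := not_conradian_on_tail sT (fun _ _ => I) ei il' iu.
split; [rewrite -tail_last; exact: convex_tail | exact: conradian_on_last |].
move=> K Kc conK x Kx; apply: contrapT => nlx; case: (Kc) => sK Kconv.
apply: (not_conradian_on_tail sK _ ei il' iu) conK.
have [_ KM KV] := sK.
have x1 : x <> 1.
  move=> x1; apply: nlx; rewrite x1.
  by case: (generated_subgroup [set s l]).
wlog [j jx] : x Kx nlx x1 / flipped s eps x.
  move=> wl; case: (flipped_total s_dehornoy eps x1); first exact: wl.
  apply: wl; first exact: KV.
  - have [_ _ V] := generated_subgroup [set s l].
    by move/V; rewrite invgK.
  - by move/(congr1 inv); rewrite invgK invg1.
have jTK := convex_absorbs_tail Kc Kx jx.
have : j <= i.
  rewrite leqNgt -il; apply/negP => lj; apply: nlx; rewrite -tail_last.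
  by apply: (tail_leq lj); apply: layer_tail jx.
rewrite leq_eqVlt => /predU1P[/val_inj ji|ji]; last first.
  by move=> t /(tail_leq ji)/jTK.
subst j.
apply: tail_min => // j; rewrite leq_eqVlt.
move=> /predU1P[/val_inj <-|ij]; last first.
  by apply: jTK; apply: tail_gen.
move: jx; rewrite /layer /= ei => /ipos_first[h [z [hP zP xE]]].
have [tz|pz] := zP.
  have -> : s i = h^-1 * x * z^-1 by rewrite xE !gnorm.
  by apply: (KM _ _ (KM _ _ (KV _ (jTK _ hP)) Kx) (KV _ (jTK _ tz))).
have -> : s i = h^-1 * (h * s i) by rewrite mulKg.
apply: KM; first exact/KV/jTK.
apply: Kconv (let: And3 K1 _ _ := sK in K1) (Kx) _ _.
  by exists i; rewrite invg1 mul1g /layer /= ei; apply/tail_ipos/ipos_gen.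
by exists i; rewrite xE mulKg /layer /= ei.
Qed.

End Soul.

(** * The conjugate of the last generator *)

Section Conjugate.
Variables (G : groupType) (n : nat) (s : 'I_n -> G).
Hypothesis s_dehornoy : defines_dehornoy_like s.
Hypothesis s_F : property_F s.
Variables l i : 'I_n.
Hypotheses (il : l = i.+1 :> nat) (ln : n = l.+1).

Let a := twisted s.
Let P := positive_words a.

Lemma ipos_last : ipos s l `<=` [set x | exists2 m, 0 < m & x = s l ^+ m].
Proof.
have t1 t : tail s l.+1 t -> t = 1 by apply: tail_eq1; rewrite -ln.
apply: ipos_ind => [|_ _ [p p0 ->] [q q0 ->]|t x /t1->|t x /t1->] /=.
- by exists 1%N; rewrite ?expg1.
- by exists (p + q); rewrite ?expgnDr // addn_gt0 p0.
- by rewrite mul1g.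
- by rewrite mulg1.
Qed.

Lemma expg_last_neq1 m : 0 < m -> s l ^+ m <> 1.
Proof.
move=> m0 sm; apply: (ipos_neq1 s_dehornoy (i := l)); rewrite -sm.
exact/iposX/ipos_gen.
Qed.

Lemma last_max (j : 'I_n) : j <= l.
Proof. by rewrite -ltnS -ln ltn_ord. Qed.

Lemma suffix_prod_last : \prod_(j < n | l <= j) s j = s l.
Proof.
rewrite suffix_prodS big_pred0 ?mulg1 // => j.
by rewrite ltnNge last_max.
Qed.

Lemma twist_sign_last : twist_sign l = false.
Proof. by rewrite /twist_sign {1}ln subSnn. Qed.

Lemma twist_sign_penult : twist_sign i = true.
Proof. by rewrite /twist_sign {1}ln il -addn2 addKn. Qed.

Lemma twisted_last : a l = (s l)^-1.
Proof. by rewrite /a /twisted suffix_prod_last {1}ln subSnn. Qed.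

Lemma twisted_penult : a i = s i * s l.
Proof.
rewrite /a /twisted suffix_prodS -il suffix_prod_last.
by rewrite {1}ln il -addn2 addKn.
Qed.

(** The inverse in the second case comes from a_n = s_n^-1. *)
Lemma positive_words_penult x :
  P i x -> ipos s i x \/ exists2 m, 0 < m & x^-1 = s l ^+ m.
Proof.
move=> Px; have [j jx] := positive_words_flipped Px.
have ix := positive_words_tail Px.
have : i <= j.
  rewrite leqNgt; apply/negP => ji.
  exact: (layer_disjoint_tail s_dehornoy ji ix jx).
rewrite leq_eqVlt => /predU1P[/val_inj ij|]; last first.
  rewrite -il leq_eqVlt => /predU1P[/val_inj lj|]; last first.
    by rewrite ltnNge last_max.
  by move: jx; rewrite -lj /layer /= twist_sign_last => /ipos_last; right.
by move: jx; rewrite -ij /layer /= twist_sign_penult; left.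
Qed.

(** With b = a_i and c = s_l, the conjugates u = b c b^-1 and v = b^-1 c b are
    positive words.  If u is not i-positive, then u^-1 = c^m with m > 0, so
    v^m = c^-1.  Then v cannot be i-positive either, so v^-1 = c^q, and
    c^(q m) = c gives m = 1: b inverts c, the excluded relation. *)
Lemma ipos_conj_last :
  a l * a i * a l <> a i -> ipos s i (s i * s l * (s i)^-1).
Proof.
move=> nondeg; set b := a i; set c := s l.
have Pl : P i.+1 (a l) by apply: positive_words_gen; rewrite il.
have [] := property_F_conj s_F Pl; rewrite twisted_last invgK -/b -/c.
have uE : s i * c * (s i)^-1 = b * c * b^-1.
  by rewrite /b twisted_penult -/c !gnorm.
rewrite uE => /positive_words_penult[//|[m m0 um]] /positive_words_penult Pv.
pose v := b^-1 * c * b.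
have vm : v ^+ m = c^-1.
  by rewrite /v -mulgA -conjgE -conjXg -um conjgE !gnorm.
case: Pv => [/(iposX m0)|[q q0 vq]].
  rewrite -/v vm => ic.
  have [_ _ tV] := tail_subgroup s i.+1.
  have ic' : tail s i.+1 c^-1 by apply/tV/tail_gen; rewrite il.
  by case: (layer_disjoint_tail s_dehornoy (eps := fun=> true) (ltnSn i) ic').
have cqm : c ^+ (q * m)%N = c by rewrite expgnA -vq expVgn vm invgK.
have qm1 : (q * m = 1)%N.
  have := muln_gt0 q m; rewrite q0 m0.
  case: (q * m)%N cqm => [|[|k]] // cE _; case: (@expg_last_neq1 k.+1 isT).
  by rewrite -(mulKg c (s l ^+ _)) -expgS cE mulVg.
have m1 : m = 1%N by move/eqP: qm1; rewrite muln_eq1 => /andP[_ /eqP].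
case: nondeg; rewrite twisted_last -/b -/c.
have cE : c = b * c^-1 * b^-1.
  by move: um; rewrite m1 expg1 -/c => {1}<-; rewrite !gnorm.
have bc : b * c^-1 = c * b by rewrite {2}cE mulgVK.
by rewrite -mulgA bc mulKg.
Qed.

End Conjugate.

Theorem theorem3 (G : groupType) (n : nat) (n_gt1 : 1 < n) (s : 'I_n -> G)
    (s_gen : generates s)
    (s_dehornoy : defines_dehornoy_like s)
    (s_F : property_F s)
    (s_nondeg :
       twisted s (last_idx n_gt1) * twisted s (penult_idx n_gt1)
         * twisted s (last_idx n_gt1)
       <> twisted s (penult_idx n_gt1)) :
  let sn := s (last_idx n_gt1) in
  let an := twisted s (last_idx n_gt1) in
  let Gn := generated [set sn] in
  [/\ ~ conradian (dehornoy_lt s),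
      is_conradian_soul (dehornoy_lt s) Gn
    & infinite_order sn] /\
  [/\ ~ conradian (twisted_lt s),
      is_conradian_soul (twisted_lt s) Gn,
      Gn = generated [set an]
    & infinite_order an].
Proof.
have ln : n = (last_idx n_gt1).+1 by rewrite /= prednK // ltnW.
have il : last_idx n_gt1 = (penult_idx n_gt1).+1 :> nat.
  by rewrite /=; case: (n) (n_gt1) => [|[|]].
move=> sn an Gn; have anE : an = sn^-1 := twisted_last s ln.
have iu := ipos_conj_last s_dehornoy s_F il ln s_nondeg.
have sn_inf : infinite_order sn := @expg_last_neq1 _ _ _ s_dehornoy _.
split.
  rewrite /dehornoy_lt.
  have -> : Sigma s = flipped s (fun=> true) by [].
  by have [] := soul_last s_dehornoy (eps := fun=> true) il ln erefl iu.
rewrite /twisted_lt twisted_coneE //.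
have [ncon soul] := soul_last s_dehornoy il ln (twist_sign_penult il ln) iu.
split=> //; first by rewrite anE; apply: generated1V.
move=> k k0; rewrite anE expVgn => /(congr1 inv).
by rewrite invgK invg1; apply: sn_inf.
Qed.
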